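(* Let $G$ be a graph with maximum degree $\Delta(G)$, and let $\Omega$ be an $SC(G)$-partition of $G$. If $X\in\Omega$, then $X$ is in at most $\Delta(G)+1$ strong coalitions, i.e. there are at most $\Delta(G)+1$ sets $Y\in\Omega$ such that $X$ and $Y$ form a strong coalition.
   Context: Graphs are finite, simple and undirected, with nonempty vertex set $V(G)$; the order is $n=|V(G)|$. A set $D\subseteq V(G)$ is a strong dominating set of $G$ if for every $x\in V(G)\setminus D$ there is $y\in D$ with $xy\in E(G)$ and $\deg(x)\le\deg(y)$. Two disjoint sets $V_1,V_2\subseteq V(G)$ form a strong coalition if neither is a strong dominating set but $V_1\cup V_2$ is a strong dominating set. A strong coalition partition of $G$ is a partition $\Omega=\{V_1,\dots,V_k\}$ of $V(G)$ into nonempty sets such that each $V_i$ either is a strong dominating set consisting of a single vertex of degree $n-1$, or is not a strong dominating set but forms a strong coalition with another set $V_j\in\Omega$ that is not a strong dominating set. The strong coalition number $SC(G)$ is the maximum cardinality of a strong coalition partition of $G$, with $SC(G)=0$ if $G$ has no strong coalition partition. An $SC(G)$-partition is a strong coalition partition of $G$ of cardinality $SC(G)$. *)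

(* Defs.v *)
From mathcomp Require Import all_boot.

Set Implicit Arguments.
Unset Strict Implicit.
Unset Printing Implicit Defensive.

(* A finite simple graph is given by a symmetric and irreflexive adjacency
   relation [e] on a nonempty finite type [V]; these three conditions are
   hypotheses of the theorems, not of the definitions below. *)

Definition degree (V : finType) (e : rel V) (x : V) : nat :=
  #|[set y | e x y]|.

Definition max_degree (V : finType) (e : rel V) : nat :=
  \max_(x : V) degree e x.

Definition strong_dominating (V : finType) (e : rel V) (D : {set V}) : bool :=
  [forall x, (x \notin D) ==>
    [exists y in D, e x y && (degree e x <= degree e y)]].

Definition strong_coalition (V : finType) (e : rel V) (A B : {set V}) : bool :=
  [&& [disjoint A & B],
      ~~ strong_dominating e A,
      ~~ strong_dominating e B
    & strong_dominating e (A :|: B)].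

(* MathComp's [partition] already requires all blocks to be nonempty. *)
Definition strong_coalition_partition (V : finType) (e : rel V)
    (Omega : {set {set V}}) : bool :=
  partition Omega [set: V] &&
  [forall A in Omega,
     (strong_dominating e A &&
        [exists v, (A == [set v]) && (degree e v == #|V| - 1)])
     || (~~ strong_dominating e A &&
        [exists B in Omega, (B != A) && strong_coalition e A B])].

(* The maximum over the empty family is 0, which is the convention for graphs
   without a strong coalition partition. *)
Definition SC (V : finType) (e : rel V) : nat :=
  \max_(Omega : {set {set V}} | strong_coalition_partition e Omega) #|Omega|.

Definition SC_partition (V : finType) (e : rel V)
    (Omega : {set {set V}}) : bool :=
  strong_coalition_partition e Omega && (#|Omega| == SC e).

(* Main.v *)
Require Import Defs.
From mathcomp Require Import all_boot.

(** If [X] has a partner at all, it is not strong dominating, so some vertex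
    [x] outside [X] is not strongly dominated by [X].  Every partner of [X]
    must then contain [x] or a neighbour of [x], that is, meet the closed
    neighbourhood of [x].  The blocks of a partition are pairwise disjoint, so
    at most [degree e x + 1] of them do. *)

(** At most [#|N|] blocks of a disjoint family meet a given set [N]. *)
Lemma card_blocks_meeting (T : finType) (P S : {set {set T}}) (N : {set T}) :
  trivIset P -> S \subset P ->
  {in S, forall B : {set T}, exists2 z, z \in N & z \in B} -> #|S| <= #|N|.
Proof.
move=> tiP /subsetP sSP meet.
apply: leq_trans (leq_imset_card (pblock P) (mem N)).
apply/subset_leq_card/subsetP => B BS.
have [z zN zB] := meet B BS.
by apply/imsetP; exists z; rewrite // (def_pblock tiP (sSP B BS) zB).
Qed.

Lemma card_closed_neighbourhood (V : finType) (e : rel V) (x : V) :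
  #|x |: [set y | e x y]| <= max_degree e + 1.
Proof.
rewrite cardsU1 addnC leq_add ?leq_b1 //.
exact: (leq_bigmax (F := degree e) x).
Qed.

Lemma not_strong_dominatingP (V : finType) (e : rel V) (X : {set V}) :
  reflect (exists2 x, x \notin X &
             forall y, y \in X -> e x y -> ~~ (degree e x <= degree e y))
          (~~ strong_dominating e X).
Proof.
rewrite negb_forall; apply: (iffP existsP) => [[x]|[x xX undom]].
  rewrite negb_imply => /andP[xX /exists_inPn undom].
  exists x => // y yX exy.
  by have := undom y yX; rewrite exy.
exists x; rewrite negb_imply xX.
by apply/exists_inPn => y yX; apply/negP => /andP[exy]; apply/negP/undom.
Qed.

(** A vertex not strongly dominated by [X] forces each partner of [X] to meet
    its closed neighbourhood. *)
Lemma coalition_meets_neighbourhood (V : finType) (e : rel V) (X Y : {set V})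
    (x : V) :
  x \notin X ->
  (forall y, y \in X -> e x y -> ~~ (degree e x <= degree e y)) ->
  strong_coalition e X Y ->
  exists2 z, z \in x |: [set y | e x y] & z \in Y.
Proof.
move=> xX undom /and4P[_ _ _ /forallP/(_ x)/implyP domXY].
have [xY|xY] := boolP (x \in Y); first by exists x; rewrite ?setU11.
have xXY : x \notin X :|: Y by rewrite inE negb_or xX.
have /exists_inP[y yXY /andP[exy le_xy]] := domXY xXY.
exists y; first by rewrite !inE exy orbT.
by case/setUP: yXY => // yX; have := undom y yX exy; rewrite le_xy.
Qed.

Theorem theorem3p6 (V : finType) (e : rel V)
    (e_sym : symmetric e) (e_irr : irreflexive e) (V_nonempty : 0 < #|V|)
    (Omega : {set {set V}}) (Omega_SC : SC_partition e Omega)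
    (X : {set V}) (X_in : X \in Omega) :
  #|[set Y in Omega | strong_coalition e X Y]| <= max_degree e + 1.
Proof.
have /andP[/andP[/and3P[_ tiO _] _] _] := Omega_SC.
have [domX|/not_strong_dominatingP[x xX undom]] :=
  boolP (strong_dominating e X).
  rewrite (_ : [set _ in _ | _] = set0) ?cards0 //.
  by apply/setP => Y; rewrite !inE /strong_coalition domX /= !andbF.
apply: leq_trans (card_closed_neighbourhood V e x).
apply: (card_blocks_meeting _ _ _ _ tiO) => [|Y].
  by apply/subsetP => Y; rewrite inE => /andP[].
by rewrite inE => /andP[_]; apply: coalition_meets_neighbourhood.
Qed.
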